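(* Let $\mathcal{B}\subset\mathcal{A}=\mathcal{U}_q(\widehat{\mathfrak{sl}}(2))$ be the quantum affine (left) coideal subalgebra defined by the root space involution $\Theta(\alpha_0)=-\alpha_1$, i.e. the subalgebra generated by the Cartan element $k_0k_1^{-1}$ and the twisted affine generators $$B_0^+=\xi_0'^{+}k_0-d_+\,\xi_1^-k_0,\qquad B_0^-=\xi_0^-k_0-d_-\,\xi_1'^{+}k_0,\qquad \xi_i'^{+}=k_i^{-1}\xi_i^+ .$$ If $d_+\,q=d_-/q=c$, where $c\in\mathbb{C}$, then $\mathcal{B}$ is a reflection algebra for a singlet boundary. That is, the intertwining equation $$(T_{1/z}\otimes\epsilon)[\Delta(b)]\,K(z)=K(z)\,(T_z\otimes\epsilon)[\Delta(b)]\qquad\text{for all }b\in\mathcal{B}$$ defines a $K$-matrix $K(z)\in\mathrm{End}(\mathcal V\otimes\mathbb{C})$ satisfying the reflection equation $$R_{12}(z/w)\,K_{13}(z)\,R_{12}(zw)\,K_{23}(w)=K_{23}(w)\,R_{12}(zw)\,K_{13}(z)\,R_{12}(z/w)$$ on $\mathcal{V}\otimes\mathcal{V}\otimes\mathbb{C}$.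
   Context: $q\in\mathbb{C}^\times$ is transcendental. $\mathcal{U}_q(\widehat{\mathfrak{sl}}(2))$ is generated by $\xi_i^\pm,k_i^{\pm1}$ ($i=0,1$) with relations $k_ik_j=k_jk_i$, $k_i\xi_j^\pm=q^{\pm\hat a_{ij}}\xi_j^\pm k_i$, $[\xi_i^+,\xi_j^-]=\delta_{ij}\frac{k_i-k_i^{-1}}{q-q^{-1}}$ and the quantum Serre relations, where $\hat a_{00}=\hat a_{11}=2$, $\hat a_{01}=\hat a_{10}=-2$; its simple roots are $\alpha_0,\alpha_1$. Coproduct and counit: $\Delta(k_i)=k_i\otimes k_i$, $\Delta(\xi_i^+)=\xi_i^+\otimes1+k_i\otimes\xi_i^+$, $\Delta(\xi_i^-)=\xi_i^-\otimes k_i^{-1}+1\otimes\xi_i^-$, $\epsilon(k_i)=1$, $\epsilon(\xi_i^\pm)=0$. A subalgebra $\mathcal B$ is a left coideal subalgebra if $\Delta(b)\in\mathcal A\otimes\mathcal B$ for all $b\in\mathcal B$. Fundamental evaluation representation on $\mathcal{V}=\mathbb{C}^2$ with basis $v_1,v_2$ and matrix units $e_{i,j}$: $T_z(\xi_1^+)=e_{1,2}$, $T_z(\xi_1^-)=e_{2,1}$, $T_z(k_1)=q\,e_{1,1}+q^{-1}e_{2,2}$, $T_z(\xi_0^+)=z\,e_{2,1}$, $T_z(\xi_0^-)=z^{-1}e_{1,2}$, $T_z(k_0)=q^{-1}e_{1,1}+q\,e_{2,2}$. The $R$-matrix on $\mathcal V\otimes\mathcal V$ in the basis $v_1\otimes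 v_1,v_1\otimes v_2,v_2\otimes v_1,v_2\otimes v_2$ is $$R(z)=\begin{pmatrix}1&0&0&0\\0&r&1-q\,r&0\\0&1-r/q&r&0\\0&0&0&1\end{pmatrix},\qquad r=\frac{z-1}{q\,z-1/q}.$$ Subscripts on $R$ and $K$ indicate the tensor factors acted on; the third factor is the one-dimensional boundary space $\mathbb{C}$ (singlet boundary).
   Formalization: The printed reflection equation fails (e.g. c=0, z=w=2); proved instead: R_21(z/w)K_13(z)R_12(zw)K_23(w)=K_23(w)R_21(zw)K_13(z)R_12(z/w), off the poles of R. K(z) is unique up to a scalar except at z=1/z=c, where any diagonal matrix intertwines. *)

(* Defs.v *)
From HB Require Import structures.
From mathcomp Require Import all_boot all_order all_algebra.
From mathcomp Require Import complex mxtens.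
From mathcomp Require Import boolp reals.

Set Implicit Arguments.
Unset Strict Implicit.
Unset Printing Implicit Defensive.

Import GRing.Theory.
Local Open Scope ring_scope.
Local Open Scope quotient_scope.

(* Associative unital algebras presented by generators and relations: terms
   in the generators modulo the least congruence which contains the algebra
   axioms and the given relations.  1 <> 0 is not part of the construction,
   so the library structure obtained is pzRingType + lmodType, not algType;
   scalars are central (palg_scalerAl, palg_scalerAr). *)

Inductive expr (K : Type) (X : Type) : Type :=
  | Gen of X
  | Cst of K
  | Add of expr K X & expr K X
  | Mul of expr K X & expr K X.

Arguments Gen {K X}.
Arguments Cst {K X}.

Declare Scope expr_scope.
Delimit Scope expr_scope with X.
Bind Scope expr_scope with expr.
Notation "s + t" := (Add s t) : expr_scope.
Notation "s * t" := (Mul s t) : expr_scope.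
Notation "s - t" := (Add s (Mul (Cst (-1)%R) t)) : expr_scope.

HB.instance Definition _ (K X : Type) := gen_eqMixin (expr K X).
HB.instance Definition _ (K X : Type) := gen_choiceMixin (expr K X).

Section Presentation.

Variables (K : fieldType) (X : Type) (E : expr K X -> expr K X -> Prop).

Inductive cong : expr K X -> expr K X -> Prop :=
  | cong_rel s t : E s t -> cong s t
  | cong_refl s : cong s s
  | cong_sym s t : cong s t -> cong t s
  | cong_trans s t u : cong s t -> cong t u -> cong s u
  | cong_add s s' t t' : cong s s' -> cong t t' -> cong (s + t) (s' + t')
  | cong_mul s s' t t' : cong s s' -> cong t t' -> cong (s * t) (s' * t')
  | cong_addA s t u : cong (s + (t + u)) (s + t + u)
  | cong_addC s t : cong (s + t) (t + s)
  | cong_add0 s : cong (Cst 0 + s) s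
  | cong_mulA s t u : cong (s * (t * u)) (s * t * u)
  | cong_mul1l s : cong (Cst 1 * s) s
  | cong_mul1r s : cong (s * Cst 1) s
  | cong_mulDl s t u : cong ((s + t) * u) (s * u + t * u)
  | cong_mulDr s t u : cong (s * (t + u)) (s * t + s * u)
  | cong_mul0 s : cong (Cst 0 * s) (Cst 0)
  | cong_cstD a b : cong (Cst (a + b)%R) (Cst a + Cst b)
  | cong_cstM a b : cong (Cst (a * b)%R) (Cst a * Cst b)
  | cong_cstC a s : cong (Cst a * s) (s * Cst a).

Definition congb : rel (expr K X) := fun s t => `[< cong s t >].

Lemma congb_refl : reflexive congb.
Proof. by move=> s; apply/asboolP; apply: cong_refl. Qed.
Lemma congb_sym : symmetric congb.
Proof. by move=> s t; apply/asboolP/asboolP; apply: cong_sym. Qed.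
Lemma congb_trans : transitive congb.
Proof.
by move=> t s u /asboolP st /asboolP tu; apply/asboolP; apply: cong_trans tu.
Qed.

Canonical congb_equiv := EquivRel congb congb_refl congb_sym congb_trans.

Definition palg : Type := {eq_quot congb}.

HB.instance Definition _ := Choice.on palg.
HB.instance Definition _ := EqQuotient.on palg.

Definition cls (s : expr K X) : palg := \pi_palg s.

Lemma clsP s t : cls s = cls t <-> cong s t.
Proof.
split; first by move/eqmodP/asboolP.
by move=> st; apply/eqmodP/asboolP.
Qed.

Lemma repr_cls s : cong (repr (cls s)) s.
Proof. by apply/clsP; rewrite /cls reprK. Qed.

Lemma cls_repr x : cls (repr x) = x.
Proof. exact: reprK. Qed.

Definition palg_add (x y : palg) := cls (repr x + repr y).
Definition palg_mul (x y : palg) := cls (repr x * repr y).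
Definition palg_scale (a : K) (x : palg) := cls (Cst a * repr x).

Lemma cls_add s t : palg_add (cls s) (cls t) = cls (s + t).
Proof. by apply/clsP; apply: cong_add; apply: repr_cls. Qed.
Lemma cls_mul s t : palg_mul (cls s) (cls t) = cls (s * t).
Proof. by apply/clsP; apply: cong_mul; apply: repr_cls. Qed.
Lemma cls_scale a s : palg_scale a (cls s) = cls (Cst a * s).
Proof.
by apply/clsP; apply: cong_mul; [apply: cong_refl | apply: repr_cls].
Qed.

Lemma palgW (P : palg -> Prop) : (forall s, P (cls s)) -> forall x, P x.
Proof. by move=> Ps x; rewrite -(cls_repr x). Qed.

Lemma palg_addA : associative palg_add.
Proof.
elim/palgW=> s; elim/palgW=> t; elim/palgW=> u.
by rewrite !cls_add; apply/clsP; apply: cong_addA.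
Qed.
Lemma palg_addC : commutative palg_add.
Proof.
elim/palgW=> s; elim/palgW=> t.
by rewrite !cls_add; apply/clsP; apply: cong_addC.
Qed.
Lemma palg_add0 : left_id (cls (Cst 0)) palg_add.
Proof.
by elim/palgW=> s; rewrite cls_add; apply/clsP; apply: cong_add0.
Qed.
Lemma palg_addN : left_inverse (cls (Cst 0)) (palg_scale (-1)) palg_add.
Proof.
elim/palgW=> s; rewrite cls_scale cls_add; apply/clsP.
apply: (@cong_trans _ (Cst (-1) * s + Cst 1 * s)%X).
  by apply: cong_add; [apply: cong_refl | apply/cong_sym/cong_mul1l].
apply: cong_trans (cong_sym (cong_mulDl _ _ _)) _.
apply: cong_trans (cong_mul0 s); apply: cong_mul; last exact: cong_refl.
by apply: cong_sym; rewrite -{1}(addNr (1 : K)); apply: cong_cstD.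
Qed.

HB.instance Definition _ :=
  GRing.isZmodule.Build palg palg_addA palg_addC palg_add0 palg_addN.

Lemma palg_mulA : associative palg_mul.
Proof.
elim/palgW=> s; elim/palgW=> t; elim/palgW=> u.
by rewrite !cls_mul; apply/clsP; apply: cong_mulA.
Qed.
Lemma palg_mul1l : left_id (cls (Cst 1)) palg_mul.
Proof.
by elim/palgW=> s; rewrite cls_mul; apply/clsP; apply: cong_mul1l.
Qed.
Lemma palg_mul1r : right_id (cls (Cst 1)) palg_mul.
Proof.
by elim/palgW=> s; rewrite cls_mul; apply/clsP; apply: cong_mul1r.
Qed.
Lemma palg_mulDl : left_distributive palg_mul palg_add.
Proof.
elim/palgW=> s; elim/palgW=> t; elim/palgW=> u.
by rewrite !(cls_add, cls_mul); apply/clsP; apply: cong_mulDl.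
Qed.
Lemma palg_mulDr : right_distributive palg_mul palg_add.
Proof.
elim/palgW=> s; elim/palgW=> t; elim/palgW=> u.
by rewrite !(cls_add, cls_mul); apply/clsP; apply: cong_mulDr.
Qed.

HB.instance Definition _ :=
  GRing.Zmodule_isPzRing.Build palg
    palg_mulA palg_mul1l palg_mul1r palg_mulDl palg_mulDr.

Lemma palg_scaleA a b v : palg_scale a (palg_scale b v) = palg_scale (a * b) v.
Proof.
elim/palgW: v => s; rewrite !cls_scale; apply/clsP.
apply: cong_trans (cong_mulA _ _ _) _.
by apply: cong_mul; [apply/cong_sym/cong_cstM | apply: cong_refl].
Qed.
Lemma palg_scale1 : left_id 1 palg_scale.
Proof.
by elim/palgW=> s; rewrite cls_scale; apply/clsP; apply: cong_mul1l.
Qed.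
Lemma palg_scaleDr : right_distributive palg_scale +%R.
Proof.
move=> a; elim/palgW=> s; elim/palgW=> t.
rewrite [LHS](_ : _ = palg_scale a (palg_add (cls s) (cls t))) //.
rewrite [RHS](_ : _ = palg_add (palg_scale a (cls s)) (palg_scale a (cls t))) //.
by rewrite cls_add !cls_scale cls_add; apply/clsP; apply: cong_mulDr.
Qed.
Lemma palg_scaleDl v : {morph palg_scale^~ v : a b / a + b}.
Proof.
move=> a b; elim/palgW: v => s.
rewrite [RHS](_ : _ = palg_add (palg_scale a (cls s)) (palg_scale b (cls s))) //.
rewrite !cls_scale cls_add; apply/clsP.
apply: cong_trans (cong_mulDl _ _ _).
by apply: cong_mul; [apply: cong_cstD | apply: cong_refl].
Qed.

HB.instance Definition _ :=
  GRing.Zmodule_isLmodule.Build K palg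
    palg_scaleA palg_scale1 palg_scaleDr palg_scaleDl.

Lemma clsD s t : cls (s + t) = cls s + cls t. Proof. by rewrite -cls_add. Qed.
Lemma clsM s t : cls (s * t) = cls s * cls t. Proof. by rewrite -cls_mul. Qed.
Lemma clsC a : cls (Cst a) = a *: (1 : palg).
Proof.
rewrite [RHS](_ : _ = palg_scale a (cls (Cst 1))) // cls_scale.
by apply/clsP/cong_sym/cong_mul1r.
Qed.

Lemma palg_scalerAl a (x y : palg) : a *: (x * y) = (a *: x) * y.
Proof.
elim/palgW: x => s; elim/palgW: y => t.
rewrite [LHS](_ : _ = palg_scale a (palg_mul (cls s) (cls t))) //.
rewrite [RHS](_ : _ = palg_mul (palg_scale a (cls s)) (cls t)) //.
by rewrite cls_mul !cls_scale cls_mul; apply/clsP; apply: cong_mulA.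
Qed.
Lemma palg_scalerAr a (x y : palg) : a *: (x * y) = x * (a *: y).
Proof.
elim/palgW: x => s; elim/palgW: y => t.
rewrite [LHS](_ : _ = palg_scale a (palg_mul (cls s) (cls t))) //.
rewrite [RHS](_ : _ = palg_mul (cls s) (palg_scale a (cls t))) //.
rewrite cls_mul !cls_scale cls_mul; apply/clsP.
apply: cong_trans (cong_mulA _ _ _) _; apply: cong_trans (cong_sym (cong_mulA _ _ _)).
by apply: cong_mul; [apply: cong_cstC | apply: cong_refl].
Qed.

(* Algebra maps out of the presented algebra, given on the generators.  The
   target B is an algebra with structure map scal : K -> B.  palg_lift is a
   total function; it is the algebra map of the universal property when f
   satisfies the relations (the lemmas palg_lift_* below).  This is the case
   for Delta_gen when q <> 0, for counit_gen always, and for eval_gen q z when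
   q, z <> 0 and q^2 <> 1. *)
Section Lift.

Variables (B : pzRingType) (scal : K -> B) (f : X -> B).

Fixpoint eval (s : expr K X) : B :=
  match s with
  | Gen x => f x
  | Cst a => scal a
  | Add s t => eval s + eval t
  | Mul s t => eval s * eval t
  end.

Definition palg_lift (x : palg) : B := eval (repr x).

Hypothesis scalD : forall a b, scal (a + b) = scal a + scal b.
Hypothesis scalM : forall a b, scal (a * b) = scal a * scal b.
Hypothesis scal1 : scal 1 = 1.
Hypothesis scalC : forall a y, scal a * y = y * scal a.
Hypothesis f_rel : forall s t, E s t -> eval s = eval t.

Lemma scal0 : scal 0 = 0.
Proof. by apply: (addrI (scal 0)); rewrite -scalD !addr0. Qed.

Lemma eval_cong s t : cong s t -> eval s = eval t.
Proof.
elim=> {s t} /=; try by [].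
- by move=> s t u _ -> _ ->.
- by move=> s s' t t' _ -> _ ->.
- by move=> s s' t t' _ -> _ ->.
- by move=> s t u; rewrite addrA.
- by move=> s t; rewrite addrC.
- by move=> s; rewrite scal0 add0r.
- by move=> s t u; rewrite mulrA.
- by move=> s; rewrite scal1 mul1r.
- by move=> s; rewrite scal1 mulr1.
- by move=> s t u; rewrite mulrDl.
- by move=> s t u; rewrite mulrDr.
- by move=> s; rewrite scal0 mul0r.
Qed.

Lemma palg_lift_cls s : palg_lift (cls s) = eval s.
Proof. exact: eval_cong (repr_cls s). Qed.

Lemma palg_liftD x y : palg_lift (x + y) = palg_lift x + palg_lift y.
Proof. by elim/palgW: x => s; elim/palgW: y => t; rewrite -clsD !palg_lift_cls. Qed.

Lemma palg_liftM x y : palg_lift (x * y) = palg_lift x * palg_lift y.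
Proof. by elim/palgW: x => s; elim/palgW: y => t; rewrite -clsM !palg_lift_cls. Qed.

Lemma palg_liftC a : palg_lift (a *: (1 : palg)) = scal a.
Proof. by rewrite -clsC palg_lift_cls. Qed.

Lemma palg_liftZ a x : palg_lift (a *: x) = scal a * palg_lift x.
Proof. by rewrite -{1}[x]mul1r palg_scalerAl palg_liftM palg_liftC. Qed.

End Lift.

End Presentation.

Arguments cls {K X} E.

Inductive uq_gen : Type :=
  | GXp of 'I_2
  | GXm of 'I_2
  | GK of 'I_2
  | GKinv of 'I_2.

Definition cartan (i j : 'I_2) : int := if i == j then 2 else - 2.

Section QuantumAffine.

Variables (K : fieldType) (q : K).

Local Notation cst a := (@Cst K uq_gen a).
Local Notation xp i := (@Gen K uq_gen (GXp i)).
Local Notation xm i := (@Gen K uq_gen (GXm i)).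
Local Notation k i := (@Gen K uq_gen (GK i)).
Local Notation kinv i := (@Gen K uq_gen (GKinv i)).

(* sum_m (-1)^m [3 choose m]_q x^(3-m) y x^m, where 3 = 1 - a_ij and
   [3]_q = q^2 + 1 + q^-2 *)
Definition serre (x y : expr K uq_gen) : expr K uq_gen :=
  let q3 := cst (q ^+ 2 + 1 + q ^- 2) in
  (x * x * x * y - q3 * (x * x * y * x) + q3 * (x * y * x * x)
    - y * x * x * x)%X.

Inductive uq_rel : expr K uq_gen -> expr K uq_gen -> Prop :=
  | uq_kV i : uq_rel (k i * kinv i) (cst 1)
  | uq_Vk i : uq_rel (kinv i * k i) (cst 1)
  | uq_kk i j : uq_rel (k i * k j) (k j * k i)
  | uq_kxp i j : uq_rel (k i * xp j) (cst (q ^ cartan i j) * (xp j * k i))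
  | uq_kxm i j : uq_rel (k i * xm j) (cst (q ^ (- cartan i j)) * (xm j * k i))
  | uq_xpxm i j : uq_rel (xp i * xm j - xm j * xp i)
      (if i == j then cst (q - q^-1)^-1 * (k i - kinv i) else cst 0)%X
  | uq_serrep (i j : 'I_2) : i != j -> uq_rel (serre (xp i) (xp j)) (cst 0)
  | uq_serrem (i j : 'I_2) : i != j -> uq_rel (serre (xm i) (xm j)) (cst 0).

Definition Uq : Type := palg uq_rel.
HB.instance Definition _ := GRing.PzRing.on Uq.
HB.instance Definition _ := GRing.Lmodule.on Uq.

Definition ugen (g : uq_gen) : Uq := cls uq_rel (Gen g).
Definition xip i := ugen (GXp i).
Definition xim i := ugen (GXm i).
Definition ku i := ugen (GK i).
Definition kuV i := ugen (GKinv i).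

(* The algebra Uq (x) Uq: generated by the pure tensors a (x) b, which are
   bilinear and multiply factorwise. *)
Local Notation cst2 a := (@Cst K (Uq * Uq) a).
Local Notation pure ab := (@Gen K (Uq * Uq) ab%R).
Inductive tens_rel : expr K (Uq * Uq) -> expr K (Uq * Uq) -> Prop :=
  | tens_Dl (a a' b : Uq) : tens_rel (pure (a + a', b)) (pure (a, b) + pure (a', b))
  | tens_Dr (a b b' : Uq) : tens_rel (pure (a, b + b')) (pure (a, b) + pure (a, b'))
  | tens_Zl (c : K) (a b : Uq) : tens_rel (pure (c *: a, b)) (cst2 c * pure (a, b))
  | tens_Zr (c : K) (a b : Uq) : tens_rel (pure (a, c *: b)) (cst2 c * pure (a, b))
  | tens_M (a a' b b' : Uq) :
      tens_rel (pure (a * a', b * b')) (pure (a, b) * pure (a', b'))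
  | tens_1 : tens_rel (pure (1, 1)) (cst2 1).

Definition UqUq : Type := palg tens_rel.
HB.instance Definition _ := GRing.PzRing.on UqUq.
HB.instance Definition _ := GRing.Lmodule.on UqUq.

Definition tens (a b : Uq) : UqUq := cls tens_rel (Gen (a, b)).

Definition Delta_gen (g : uq_gen) : UqUq :=
  match g with
  | GXp i => tens (xip i) 1 + tens (ku i) (xip i)
  | GXm i => tens (xim i) (kuV i) + tens 1 (xim i)
  | GK i => tens (ku i) (ku i)
  | GKinv i => tens (kuV i) (kuV i)
  end.

Definition Delta : Uq -> UqUq := palg_lift (fun a => a *: (1 : UqUq)) Delta_gen.

Definition counit_gen (g : uq_gen) : K :=
  match g with
  | GXp _ | GXm _ => 0
  | GK _ | GKinv _ => 1
  end.

Definition counit : Uq -> K := palg_lift id counit_gen.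

(* e_{1,2} of the basis v_1, v_2 is delta_mx 0 1; the inverse of k_i is mapped
   to the inverse matrix. *)
Definition eval_gen (z : K) (g : uq_gen) : 'M[K]_2 :=
  let e11 := delta_mx 0 0 in let e12 := delta_mx 0 1 in
  let e21 := delta_mx 1 0 in let e22 := delta_mx 1 1 in
  match g with
  | GXp i => if i == 0 then z *: e21 else e12
  | GXm i => if i == 0 then z^-1 *: e12 else e21
  | GK i => if i == 0 then q^-1 *: e11 + q *: e22 else q *: e11 + q^-1 *: e22
  | GKinv i => if i == 0 then q *: e11 + q^-1 *: e22 else q^-1 *: e11 + q *: e22
  end.

Definition evalT (z : K) : Uq -> 'M[K]_2 :=
  palg_lift (@scalar_mx K 2) (eval_gen z).

(* T_z (x) epsilon, with values in End(V (x) C); the tensor product of matrices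
   uses the lexicographic order of the basis vectors. *)
Definition evalT_counit (z : K) : UqUq -> 'M[K]_(2 * 1) :=
  palg_lift (@scalar_mx K (2 * 1))
    (fun ab => tensmx (evalT z ab.1) (counit ab.2)%:M).

Inductive subalgebra_gen (S : Uq -> Prop) : Uq -> Prop :=
  | sg_in x : S x -> subalgebra_gen S x
  | sg_1 : subalgebra_gen S 1
  | sg_D x y :
      subalgebra_gen S x -> subalgebra_gen S y -> subalgebra_gen S (x + y)
  | sg_Z a x : subalgebra_gen S x -> subalgebra_gen S (a *: x)
  | sg_M x y :
      subalgebra_gen S x -> subalgebra_gen S y -> subalgebra_gen S (x * y).

Definition left_coideal (S : Uq -> Prop) : Prop :=
  forall b, S b -> exists (n : nat) (x y : 'I_n -> Uq),
    (forall i, S (y i)) /\ Delta b = \sum_(i < n) tens (x i) (y i).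

Definition xip' (i : 'I_2) : Uq := kuV i * xip i.

Variables dp dm : K.

Definition B0p : Uq := xip' 0 * ku 0 - dp *: (xim 1 * ku 0).
Definition B0m : Uq := xim 0 * ku 0 - dm *: (xip' 1 * ku 0).

Definition Bsub : Uq -> Prop :=
  subalgebra_gen (fun x => [\/ x = ku 0 * kuV 1, x = B0p | x = B0m]).

Definition intertwines (z : K) (Kz : 'M[K]_(2 * 1)) : Prop :=
  forall b, Bsub b ->
    evalT_counit z^-1 (Delta b) *m Kz = Kz *m evalT_counit z (Delta b).

End QuantumAffine.

Arguments Bsub {K} q dp dm b.
Arguments intertwines {K} q dp dm z Kz.

Section Legs.

Variable K : fieldType.

Definition Rmat (q z : K) : 'M[K]_(2 * 2) :=
  let r := (z - 1) / (q * z - q^-1) in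
  \matrix_(i, j)
    nth 0 (nth [::]
      [:: [:: 1;         0;           0; 0];
          [:: 0;         r; 1 - q * r  ; 0];
          [:: 0; 1 - r / q;           r; 0];
          [:: 0;         0;           0; 1]] i) j.

Definition leg1 (a : 'I_(2 * 2 * 1)) : 'I_2 :=
  (mxtens_unindex (mxtens_unindex a).1).1.
Definition leg2 (a : 'I_(2 * 2 * 1)) : 'I_2 :=
  (mxtens_unindex (mxtens_unindex a).1).2.
Definition leg3 (a : 'I_(2 * 2 * 1)) : 'I_1 := (mxtens_unindex a).2.

(* M_{uv} for M an operator on two factors: M acts on the factors u and v, in
   this order, and the identity acts on the remaining factor w. *)
Definition on_legs m n p (u : 'I_(2 * 2 * 1) -> 'I_m)
    (v : 'I_(2 * 2 * 1) -> 'I_n) (w : 'I_(2 * 2 * 1) -> 'I_p)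
    (M : 'M[K]_(m * n)) : 'M[K]_(2 * 2 * 1) :=
  \matrix_(a, b) (M (mxtens_index (u a, v a)) (mxtens_index (u b, v b))
                  *+ (w a == w b)).

Definition R12 q z := on_legs leg1 leg2 leg3 (Rmat q z).
Definition R21 q z := on_legs leg2 leg1 leg3 (Rmat q z).
Definition on13 := on_legs leg1 leg3 leg2.
Definition on23 := on_legs leg2 leg3 leg1.

(* The operator R attached to a crossing acts on the two tensor factors in the
   order in which they stand when they cross.  Both sides go from
   V_z (x) V_w (x) C to V_(1/z) (x) V_(1/w) (x) C through one R and one K at a
   time; each side crosses the factors twice, the first time (rightmost R) in
   the order 1,2 and the second time in the order 2,1:
     left:  K_23(w), R_12(zw)  : V_z V_(1/w) -> V_(1/w) V_z,
            K_13(z), R_21(z/w) : V_(1/w) V_(1/z) -> V_(1/z) V_(1/w);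
     right: R_12(z/w) : V_z V_w -> V_w V_z,
            K_13(z), R_21(zw)  : V_w V_(1/z) -> V_(1/z) V_w, K_23(w).
   As 1 - q r <> 1 - r/q, R_21 differs from R_12.  Equivalently, with
   R' = P R for the flip P, this is
     R'(z/w) K_23(z) R'(zw) K_23(w) = K_23(w) R'(zw) K_23(z) R'(z/w). *)
Definition reflection_eq q z w (Kz Kw : 'M[K]_(2 * 1)) : Prop :=
  R21 q (z / w) *m on13 Kz *m R12 q (z * w) *m on23 Kw
  = on23 Kw *m R21 q (z * w) *m on13 Kz *m R12 q (z / w).

End Legs.

(* Main.v *)
(** The coproduct, the counit and the evaluation maps respect the defining
    relations.  For the Serre relations of the coproduct, write the Serre
    polynomial as [x, [x, [x, y]_s]_1]_(1/s) with [x, y]_s = x y - s y x, where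
    s may be q^2 or q^-2.  The two summands of the coproduct of a generator
    q-commute, so the mixed terms die one bracket at a time, provided one picks
    s = q^-2 for one summand of y and s = q^2 for the other.

    Since (id (x) epsilon) o Delta = id, intertwining only has to be tested on
    the three generators of B: the Cartan one makes K(z) diagonal because
    q^4 <> 1, and both B_0^+ and B_0^- give
    (1/z - c) K(z)_11 = (z - c) K(z)_22.  This determines K(z) up to a scalar
    unless z = 1/z = c.  For diagonal K the reflection equation reduces to one
    polynomial identity, which also holds in the exceptional case. *)

Require Import Defs.
From mathcomp Require Import all_boot all_order all_algebra.
From mathcomp Require Import complex mxtens reals ring.

Set Implicit Arguments.
Unset Strict Implicit.
Unset Printing Implicit Defensive.

Import GRing.Theory.
Local Open Scope ring_scope.

(** * The Serre polynomial as an iterated q-bracket *)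

Section PresentedAlgebra.

Variables (K : fieldType) (X : Type) (E : expr K X -> expr K X -> Prop).
Implicit Types (a b c s : K) (x y A B C D : palg E).

Local Notation scal a := (a *: (1 : palg E)).

Lemma scal_mull a x : scal a * x = a *: x.
Proof. by rewrite -palg_scalerAl mul1r. Qed.

Lemma scal_central a x : scal a * x = x * scal a.
Proof. by rewrite -palg_scalerAl -palg_scalerAr mul1r mulr1. Qed.

Lemma scal_morphM a b : scal (a * b) = scal a * scal b.
Proof. by rewrite scal_mull scalerA. Qed.

Definition qbracket s x y : palg E := x * y - s *: (y * x).

(** Left and right multiplication by x are commuting operators L and R, so the left side is (L -
    aR)(L - bR)(L - cR) applied to y. The coefficients are the elementary symmetric polynomials in
    a, b, c. *)
Lemma qbracket3 a b c x y :
  qbracket a x (qbracket b x (qbracket c x y)) =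
  x * x * x * y - (a + b + c) *: (x * x * y * x)
  + (a * b + a * c + b * c) *: (x * y * x * x) - (a * b * c) *: (y * x * x * x).
Proof.
rewrite /qbracket !(mulrBr, mulrBl, scalerBr, =^~ palg_scalerAr, =^~ palg_scalerAl,
  scalerA, mulrA, scalerDl, opprB, opprD, opprK).
set m1 := x * x * y * x; set m2 := x * y * x * x.
rewrite -!addrA; congr (_ + _).
by rewrite !addrA [LHS](+%R.[ACl 7*3*1*4*6*2*5]).
Qed.

(** At t = q^2 the coefficient is [3]_q, and this is the value of the term [serre]. *)
Definition qserre t x y : palg E :=
  x * x * x * y - (t + 1 + t^-1) *: (x * x * y * x)
  + (t + 1 + t^-1) *: (x * y * x * x) - y * x * x * x.

Lemma qserre_qbracket t x y : t != 0 ->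
  qserre t x y = qbracket t x (qbracket 1 x (qbracket t^-1 x y)).
Proof.
by move=> t0; rewrite qbracket3 !(mulr1, mul1r) divff // scale1r.
Qed.

(** The set {t, 1, t^-1} is stable under inversion, so the brackets may also be nested in the
    opposite order. [qserreD] uses one order for each summand of the second argument. *)
Lemma qserre_qbracketV t x y : t != 0 ->
  qserre t x y = qbracket t^-1 x (qbracket 1 x (qbracket t x y)).
Proof.
move=> t0; rewrite qbracket3 !(mulr1, mul1r) mulVf // scale1r.
by rewrite (_ : t^-1 + 1 + t = t + 1 + t^-1) //; ring.
Qed.

Lemma qbracketDl s x x' y : qbracket s (x + x') y = qbracket s x y + qbracket s x' y.
Proof. by rewrite /qbracket mulrDl mulrDr scalerDr opprD addrACA. Qed.

Lemma qbracketDr s x y y' : qbracket s x (y + y') = qbracket s x y + qbracket s x y'.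
Proof. by rewrite /qbracket mulrDl mulrDr scalerDr opprD addrACA. Qed.

Lemma qbracket0 s x y : x * y = s *: (y * x) -> qbracket s x y = 0.
Proof. by move=> xy; rewrite /qbracket xy subrr. Qed.

(** Moving B past a word costs one factor per letter, and both words of the bracket consist of one A
    and one C. *)
Lemma qcomm_qbracket r u s B A C :
  B * A = r *: (A * B) -> B * C = u *: (C * B) ->
  B * qbracket s A C = (r * u) *: (qbracket s A C * B).
Proof.
move=> BA BC; rewrite /qbracket mulrBr mulrBl scalerBr; congr (_ - _).
  by rewrite mulrA BA -palg_scalerAl -mulrA BC -palg_scalerAr scalerA mulrA.
rewrite -palg_scalerAr mulrA BC -palg_scalerAl -mulrA BA -!palg_scalerAr.
by rewrite -palg_scalerAl !scalerA !mulrA; congr (_ *: _); ring.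
Qed.

(** B moves past C with factor t^-1, and each bracketing with A multiplies this by t: the factors
    t^-1, 1, t are the bracket parameters from the inside out, so B drops out of every bracket over
    C. Over D the roles are exchanged: A has the factors t, 1, t^-1 and drops out. *)
Lemma qserreD t A B C D : t != 0 ->
  B * A = t *: (A * B) -> B * C = t^-1 *: (C * B) -> A * D = t *: (D * A) ->
  qserre t A C = 0 -> qserre t B D = 0 -> qserre t (A + B) (C + D) = 0.
Proof.
move=> t0 BA BC AD AC BD.
have AB : A * B = t^-1 *: (B * A) by rewrite BA scalerA mulVf // scale1r.
have serreDr x y y' : qserre t x (y + y') = qserre t x y + qserre t x y'.
  by rewrite !qserre_qbracket // !qbracketDr.
rewrite serreDr [qserre _ _ C]qserre_qbracket // [qserre _ _ D]qserre_qbracketV //.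
have C1 := qcomm_qbracket t^-1 BA BC; rewrite mulfV // in C1.
have C2 := qcomm_qbracket 1 BA C1; rewrite mulr1 in C2.
have D1 := qcomm_qbracket t AB AD; rewrite mulVf // in D1.
have D2 := qcomm_qbracket 1 AB D1; rewrite mulr1 in D2.
rewrite (qbracketDl _ _ _ C) (qbracket0 BC) addr0.
rewrite (qbracketDl _ _ _ (qbracket _ A C)) (qbracket0 C1) addr0.
rewrite (qbracketDl _ _ _ (qbracket _ A _)) (qbracket0 C2) addr0.
rewrite (qbracketDl _ _ _ D) (qbracket0 AD) add0r.
rewrite (qbracketDl _ _ _ (qbracket _ B D)) (qbracket0 D1) add0r.
rewrite (qbracketDl _ _ _ (qbracket _ B _)) (qbracket0 D2) add0r.
by rewrite -qserre_qbracket // -qserre_qbracketV // AC BD addr0.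
Qed.

(** Turns a defining relation between terms into an equation between elements of the algebra. *)
Lemma cls_eval (t : expr K X) :
  cls E t = eval (fun a => scal a) (fun g => cls E (Gen g)) t.
Proof.
elim: t => //= [a|s IHs t IHt|s IHs t IHt]; first exact: clsC.
  by rewrite clsD IHs IHt.
by rewrite clsM IHs IHt.
Qed.

End PresentedAlgebra.

(** * Relations in [Uq] and in its tensor square *)

Section QuantumAffine.

Variables (K : fieldType) (q : K).
Hypothesis q_neq0 : q != 0.

Let q2_neq0 : q ^+ 2 != 0. Proof. by rewrite expf_neq0. Qed.

Local Notation xp := (@xip K q).
Local Notation xm := (@xim K q).
Local Notation k := (@ku K q).
Local Notation kV := (@kuV K q).
Local Notation tens := (@tens K q).

Lemma Uq_rel s t : uq_rel q s t ->
  eval (fun a => a *: (1 : Uq q)) (ugen q) s =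
  eval (fun a => a *: (1 : Uq q)) (ugen q) t.
Proof.
move=> st; have : cls (uq_rel q) s = cls (uq_rel q) t by apply/clsP/cong_rel.
by rewrite !cls_eval.
Qed.

Lemma kukV i : k i * kV i = 1.
Proof. by have /= -> := Uq_rel (uq_kV q i); rewrite scale1r. Qed.

Lemma kuVk i : kV i * k i = 1.
Proof. by have /= -> := Uq_rel (uq_Vk q i); rewrite scale1r. Qed.

Lemma ku_comm i j : k i * k j = k j * k i.
Proof. exact: Uq_rel (uq_kk q i j). Qed.

Lemma ku_xip i j : k i * xp j = q ^ cartan i j *: (xp j * k i).
Proof. by have /= -> := Uq_rel (uq_kxp q i j); rewrite scal_mull. Qed.

Lemma ku_xim i j : k i * xm j = q ^ (- cartan i j) *: (xm j * k i).
Proof. by have /= -> := Uq_rel (uq_kxm q i j); rewrite scal_mull. Qed.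

Lemma xip_xim i j : xp i * xm j - xm j * xp i =
  if i == j then (q - q^-1)^-1 *: (k i - kV i) else 0.
Proof.
have := Uq_rel (uq_xpxm q i j); rewrite /= scal_mull scaleN1r => ->.
by case: eqP => _ /=; rewrite ?scal_mull ?scaleN1r ?scale0r.
Qed.

Lemma eval_serre (X : Type) (E : expr K X -> expr K X -> Prop)
    (f : uq_gen -> palg E) s t :
  eval (fun a => a *: (1 : palg E)) f (serre q s t) =
  qserre (q ^+ 2) (eval (fun a => a *: (1 : palg E)) f s)
                  (eval (fun a => a *: (1 : palg E)) f t).
Proof. by rewrite /= !scal_mull !scaleN1r. Qed.

Lemma xip_serre i j : i != j -> qserre (q ^+ 2) (xp i) (xp j) = 0.
Proof.
move=> ij; have := Uq_rel (uq_serrep q ij).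
by rewrite eval_serre /= scale0r.
Qed.

Lemma xim_serre i j : i != j -> qserre (q ^+ 2) (xm i) (xm j) = 0.
Proof.
move=> ij; have := Uq_rel (uq_serrem q ij).
by rewrite eval_serre /= scale0r.
Qed.

Lemma tens_relE s t : tens_rel s t ->
  eval (fun a => a *: (1 : UqUq q)) (fun ab => tens ab.1 ab.2) s =
  eval (fun a => a *: (1 : UqUq q)) (fun ab => tens ab.1 ab.2) t.
Proof.
move=> st; have : cls (@tens_rel _ q) s = cls (@tens_rel _ q) t.
  exact/clsP/cong_rel.
rewrite !cls_eval.
(* The two maps on generators differ only by eta for pairs. *)
have E u : eval (fun a => a *: (1 : UqUq q)) (fun ab => cls (@tens_rel _ q) (Gen ab)) u =
  eval (fun a => a *: (1 : UqUq q)) (fun ab => tens ab.1 ab.2) u.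
  by elim: u => //= [[] //|u -> v ->|u -> v ->].
by rewrite -!E.
Qed.

Lemma tensDl a a' b : tens (a + a') b = tens a b + tens a' b.
Proof. exact: tens_relE (tens_Dl a a' b). Qed.

Lemma tensDr a b b' : tens a (b + b') = tens a b + tens a b'.
Proof. exact: tens_relE (tens_Dr a b b'). Qed.

Lemma tensZl c a b : tens (c *: a) b = c *: tens a b.
Proof. by have /= -> := tens_relE (tens_Zl c a b); rewrite scal_mull. Qed.

Lemma tensZr c a b : tens a (c *: b) = c *: tens a b.
Proof. by have /= -> := tens_relE (tens_Zr c a b); rewrite scal_mull. Qed.

Lemma tensM a a' b b' : tens a b * tens a' b' = tens (a * a') (b * b').
Proof. by have /= -> := tens_relE (tens_M a a' b b'). Qed.

Lemma tens11 : tens 1 1 = 1.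
Proof. by have /= -> := tens_relE (tens_1 q); rewrite scale1r. Qed.

Lemma tensNl a b : tens (- a) b = - tens a b.
Proof. by rewrite -scaleN1r tensZl scaleN1r. Qed.

Lemma tensNr a b : tens a (- b) = - tens a b.
Proof. by rewrite -scaleN1r tensZr scaleN1r. Qed.

Lemma tens0l b : tens 0 b = 0.
Proof. by rewrite -(scale0r 0) tensZl scale0r. Qed.

Lemma tens0r a : tens a 0 = 0.
Proof. by rewrite -(scale0r 0) tensZr scale0r. Qed.

Lemma cartanC i j : cartan i j = cartan j i.
Proof. by rewrite /cartan eq_sym. Qed.

Lemma kuV_comml i j : kV i * k j = k j * kV i.
Proof. by rewrite -[LHS]mulr1 -(kukV i) mulrA -(mulrA (kV i)) -ku_comm mulrA kuVk mul1r. Qed.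

Lemma kuV_comm i j : kV i * kV j = kV j * kV i.
Proof. by rewrite -[LHS]mulr1 -(kukV i) mulrA -(mulrA (kV i)) kuV_comml mulrA kuVk mul1r. Qed.

Lemma kuV_qcomm (i : 'I_2) (t : K) (x : Uq q) : t != 0 ->
  k i * x = t *: (x * k i) -> x * kV i = t *: (kV i * x).
Proof.
move=> t0 kx; rewrite -[LHS]mul1r -(kuVk i) -mulrA (mulrA (k i)) kx.
by rewrite -palg_scalerAl -palg_scalerAr -!mulrA kukV mulr1.
Qed.

Lemma xip_kuV i j : xp j * kV i = q ^ cartan i j *: (kV i * xp j).
Proof. by apply: kuV_qcomm (ku_xip i j); rewrite expfz_neq0. Qed.

Lemma xim_kuV i j : xm j * kV i = q ^ (- cartan i j) *: (kV i * xm j).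
Proof. by apply: kuV_qcomm (ku_xim i j); rewrite expfz_neq0. Qed.

(** * The coproduct respects the defining relations *)

Lemma qserre_tensl t x y a b : a * b = b * a ->
  qserre t (tens x a) (tens y b) = tens (qserre t x y) (a * a * a * b).
Proof.
move=> ab; rewrite /qserre !tensM !(tensDl, tensNl, tensZl).
(* As a and b commute, all four Serre monomials have the same second factor a^3 b. *)
have abA z : b * (a * z) = a * (b * z) by rewrite !mulrA ab.
by rewrite -!mulrA !(abA, esym ab).
Qed.

Lemma qserre_tensr t x y a b : a * b = b * a ->
  qserre t (tens a x) (tens b y) = tens (a * a * a * b) (qserre t x y).
Proof.
move=> ab; rewrite /qserre !tensM !(tensDr, tensNr, tensZr).
have abA z : b * (a * z) = a * (b * z) by rewrite !mulrA ab.
by rewrite -!mulrA !(abA, esym ab).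
Qed.

Lemma Delta_serrep i j : i != j ->
  qserre (q ^+ 2) (Delta_gen q (GXp i)) (Delta_gen q (GXp j)) = 0.
Proof.
move=> ij; have cii l : cartan l l = 2 by rewrite /cartan eqxx.
have cij : cartan i j = - 2 by rewrite /cartan (negPf ij).
(* Here A, C are the summands xi^+ (x) 1 and B, D the summands k (x) xi^+, with t = q^2. *)
apply: qserreD => //; rewrite ?tensM ?mul1r ?mulr1.
- by rewrite ku_xip cii tensZl.
- by rewrite ku_xip cij tensZl.
- by rewrite ku_xip cartanC cij tensZl scalerA -exprnN mulfV // scale1r.
- by rewrite qserre_tensl ?xip_serre ?tens0l.
- by rewrite qserre_tensr ?xip_serre ?tens0r // ku_comm.
Qed.

Lemma Delta_serrem i j : i != j ->
  qserre (q ^+ 2) (Delta_gen q (GXm i)) (Delta_gen q (GXm j)) = 0.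
Proof.
move=> ij; have cii l : cartan l l = 2 by rewrite /cartan eqxx.
have cij : cartan i j = - 2 by rewrite /cartan (negPf ij).
(* With 1 (x) xi^- in front, B A = q^2 A B as [qserreD] requires; the original order would give
   q^-2. *)
rewrite /= ![tens (xm _) _ + _]addrC.
apply: qserreD => //; rewrite ?tensM ?mul1r ?mulr1.
- by rewrite xim_kuV cii tensZr scalerA -exprnN mulfV // scale1r.
- by rewrite xim_kuV cij opprK tensZr scalerA exprnP mulVf // scale1r.
- by rewrite xim_kuV cartanC cij opprK tensZr.
- by rewrite qserre_tensr ?xim_serre ?tens0r.
- by rewrite qserre_tensl ?xim_serre ?tens0l // kuV_comm.
Qed.

Lemma Delta_rel s t : uq_rel q s t ->
  eval (fun a => a *: (1 : UqUq q)) (Delta_gen q) s =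
  eval (fun a => a *: (1 : UqUq q)) (Delta_gen q) t.
Proof.
case=> [i|i|i j|i j|i j|i j|i j ij|i j ij]; last 2 first.
- by rewrite eval_serre /= (Delta_serrep ij) scale0r.
- by rewrite eval_serre /= (Delta_serrem ij) scale0r.
all: rewrite /=.
- by rewrite tensM !kukV tens11 scale1r.
- by rewrite tensM !kuVk tens11 scale1r.
- by rewrite !tensM (ku_comm i j).
- rewrite scal_mull mulrDl mulrDr !tensM !mul1r !mulr1 scalerDr.
  by rewrite !ku_xip tensZl tensZr (ku_comm i j).
- rewrite scal_mull mulrDl mulrDr !tensM !mul1r !mulr1 scalerDr.
  by rewrite !ku_xim tensZl tensZr kuV_comml.
rewrite scal_mull scaleN1r !(mulrDl, mulrDr) !tensM !mul1r !mulr1.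
(* The mixed terms cancel in the commutator: the two tensor factors contribute inverse powers of
   q. *)
have -> : tens (k i * xm j) (xp i * kV j) = tens (xm j * k i) (kV j * xp i).
  rewrite ku_xim xip_kuV tensZl tensZr scalerA cartanC -expfzDr // addNr.
  by rewrite expr0z scale1r.
have /eqP := xip_xim i j; rewrite subr_eq => /eqP ->.
rewrite tensDl tensDr.
have regroup (V : zmodType) (a m u v b n : V) :
    a + m + u + (v + (b + n)) - (m + v + (u + n)) = a + b.
  rewrite (_ : a + m + u + (v + (b + n)) = a + b + (m + v + (u + n))) ?addrK //.
  by rewrite !addrA [LHS](+%R.[ACl 1*5*2*4*3*6]).
rewrite regroup; case: eqP => [<-|_] /=; last by rewrite tens0l tens0r addr0 scale0r.
(* For i = j the sum (k - k^-1) (x) k^-1 + k (x) (k - k^-1) telescopes to k (x) k - k^-1 (x)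
   k^-1. *)
rewrite !scal_mull scaleN1r tensZl tensZr -scalerDr tensDl tensDr tensNl tensNr.
by congr (_ *: _); rewrite [LHS]addrC addrA subrK.
Qed.

Lemma Delta_cls s : Delta (cls (uq_rel q) s) =
  eval (fun a => a *: (1 : UqUq q)) (Delta_gen q) s.
Proof.
apply: palg_lift_cls Delta_rel s.
- by move=> a b; rewrite scalerDl.
- exact: scal_morphM.
- exact: scale1r.
- exact: scal_central.
Qed.

Lemma Delta_ugen g : Delta (ugen q g) = Delta_gen q g.
Proof. exact: Delta_cls. Qed.

Lemma DeltaD x y : Delta (x + y) = Delta x + Delta y :> UqUq q.
Proof.
by elim/palgW: x => s; elim/palgW: y => t; rewrite -clsD !Delta_cls.
Qed.

Lemma DeltaM x y : Delta (x * y) = Delta x * Delta y :> UqUq q.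
Proof.
by elim/palgW: x => s; elim/palgW: y => t; rewrite -clsM !Delta_cls.
Qed.

Lemma Delta1 : Delta (1 : Uq q) = 1.
Proof. by rewrite [LHS]Delta_cls /= scale1r. Qed.

Lemma DeltaZ a (x : Uq q) : Delta (a *: x) = a *: Delta x.
Proof.
by rewrite -[a *: x]scal_mull DeltaM -clsC Delta_cls /= scal_mull.
Qed.

(** * The left coideal property *)

(** An inductive form of the indexed sums in [left_coideal]: closure under sums and products follows
    by induction, without handling index sets. *)
Inductive coideal_sum (S : Uq q -> Prop) : UqUq q -> Prop :=
  | coideal_sum0 : coideal_sum S 0
  | coideal_sumD x y t : S y -> coideal_sum S t -> coideal_sum S (tens x y + t).

Section CoidealSum.

Variable S : Uq q -> Prop.
Hypothesis S_mul : forall x y, S x -> S y -> S (x * y).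

Lemma coideal_sum_tens x y : S y -> coideal_sum S (tens x y).
Proof. by move=> Sy; rewrite -[tens x y]addr0; constructor=> //; constructor. Qed.

Lemma coideal_sum_add t u : coideal_sum S t -> coideal_sum S u -> coideal_sum S (t + u).
Proof.
elim=> [|x y {}t Sy _ IHt] Su; first by rewrite add0r.
by rewrite -addrA; constructor=> //; apply: IHt.
Qed.

Lemma coideal_sum_scale a t : coideal_sum S t -> coideal_sum S (a *: t).
Proof.
elim=> [|x y {}t Sy _ IHt]; first by rewrite scaler0; constructor.
by rewrite scalerDr -tensZl; constructor.
Qed.

Lemma coideal_sum_mul t u : coideal_sum S t -> coideal_sum S u -> coideal_sum S (t * u).
Proof.
move=> St Su; elim: St => [|x y {}t Sy _ IHt]; first by rewrite mul0r; constructor.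
rewrite mulrDl; apply: coideal_sum_add IHt.
elim: Su => [|x' y' {}u Sy' _ IHu]; first by rewrite mulr0; constructor.
by rewrite mulrDr tensM; constructor=> //; apply: S_mul.
Qed.

Lemma coideal_sumP t : coideal_sum S t ->
  exists (n : nat) (x y : 'I_n -> Uq q),
    (forall i, S (y i)) /\ t = \sum_(i < n) tens (x i) (y i).
Proof.
elim=> [|x y {}t Sy _ [n [xs [ys [Sys ->]]]]].
  by exists 0, (fun=> 0), (fun=> 0); split=> [[]//|]; rewrite big_ord0.
(* [unlift ord0] is [None] at index 0, so x and y are prepended to the families. *)
exists n.+1, (fun i => oapp xs x (unlift ord0 i)), (fun i => oapp ys y (unlift ord0 i)).
split=> [i|]; first by case: (unlift _ i).
rewrite big_ord_recl unlift_none /=; congr (_ + _).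
by apply: eq_bigr => i _; rewrite liftK.
Qed.

End CoidealSum.

(** [Delta] is an algebra map, so only generators matter. In the coproduct of either twisted
    generator the right-hand factors are the generator itself, 1, and [kk]; the last arises as
    k_1^-1 k_0. *)
Lemma Bsub_left_coideal dp dm : left_coideal (Bsub q dp dm).
Proof.
pose S := Bsub q dp dm; pose kk := k 0 * kV 1.
have Skk : S kk by apply: sg_in; constructor 1.
have SB0p : S (B0p q dp) by apply: sg_in; constructor 2.
have SB0m : S (B0m q dm) by apply: sg_in; constructor 3.
have S1 : S 1 by apply: sg_1.
have SM x y : S x -> S y -> S (x * y) by apply: sg_M.
move=> b Sb; apply: coideal_sumP; elim: b / Sb.
- move=> b [] -> {b}.
  + by rewrite DeltaM !Delta_ugen /= tensM; apply: coideal_sum_tens.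
  + rewrite (_ : Delta _ = tens (k 0) (B0p q dp) + tens (kV 0 * xp 0 * k 0) 1
        + - dp *: tens (xm 1 * k 0) kk).
      by do ![apply: coideal_sum_add | apply: coideal_sum_scale];
         apply: coideal_sum_tens.
    rewrite /B0p /xip' -scaleNr DeltaD DeltaZ !DeltaM !Delta_ugen /=.
    rewrite !(mulrDl, mulrDr) !tensM kuVk !mul1r !mulr1 (kuV_comml 1 0) kuVk.
    by rewrite scalerDr tensDr tensZr !addrA [LHS](+%R.[ACl 2*4*1*3]).
  + rewrite (_ : Delta _ = tens (k 0) (B0m q dm) + tens (xm 0 * k 0) 1
        + - dm *: tens (kV 1 * xp 1 * k 0) kk).
      by do ![apply: coideal_sum_add | apply: coideal_sum_scale];
         apply: coideal_sum_tens.
    rewrite /B0m /xip' -scaleNr DeltaD DeltaZ !DeltaM !Delta_ugen /=.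
    rewrite !(mulrDl, mulrDr) !tensM !kuVk !mul1r !mulr1 (kuV_comml 1 0).
    by rewrite scalerDr tensDr tensZr !addrA [LHS](+%R.[ACl 2*4*1*3]).
- by rewrite Delta1 -tens11; apply: coideal_sum_tens.
- by move=> x y _ Sx _ Sy; rewrite DeltaD; apply: coideal_sum_add.
- by move=> a x _ Sx; rewrite DeltaZ; apply: coideal_sum_scale.
- by move=> x y _ Sx _ Sy; rewrite DeltaM; apply: coideal_sum_mul.
Qed.

(** * Evaluation representation and counit, with explicit 2 by 2 matrices *)

Definition mx2 (a b c d : K) : 'M[K]_2 :=
  \matrix_(i, j) if i == 0 then if j == 0 then a else b else if j == 0 then c else d.

Lemma ord2_ind (P : 'I_2 -> Prop) : P 0 -> P 1 -> forall i, P i.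
Proof.
by move=> P0 P1 [[|[|//]] lt]; [rewrite (_ : Ordinal _ = 0) | rewrite (_ : Ordinal _ = 1)];
  rewrite //; apply/val_inj.
Qed.

Lemma mx2_eta (A : 'M[K]_2) : A = mx2 (A 0 0) (A 0 1) (A 1 0) (A 1 1).
Proof. by apply/matrixP; do 2!elim/ord2_ind; rewrite mxE. Qed.

Lemma mx2_inj a b c d a' b' c' d' :
  mx2 a b c d = mx2 a' b' c' d' -> [/\ a = a', b = b', c = c' & d = d'].
Proof.
move/matrixP=> e; have := e 0 0; have := e 0 1; have := e 1 0; have := e 1 1.
by rewrite !mxE.
Qed.

Lemma mx2M a b c d a' b' c' d' : mx2 a b c d * mx2 a' b' c' d' =
  mx2 (a * a' + b * c') (a * b' + b * d') (c * a' + d * c') (c * b' + d * d').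
Proof.
by apply/matrixP; do 2!elim/ord2_ind; rewrite !mxE !big_ord_recl big_ord0 !mxE addr0.
Qed.

Lemma mx2D a b c d a' b' c' d' :
  mx2 a b c d + mx2 a' b' c' d' = mx2 (a + a') (b + b') (c + c') (d + d').
Proof. by apply/matrixP; do 2!elim/ord2_ind; rewrite !mxE. Qed.

Lemma mx2N a b c d : - mx2 a b c d = mx2 (- a) (- b) (- c) (- d).
Proof. by apply/matrixP; do 2!elim/ord2_ind; rewrite !mxE. Qed.

Lemma mx2Z s a b c d : s *: mx2 a b c d = mx2 (s * a) (s * b) (s * c) (s * d).
Proof. by apply/matrixP; do 2!elim/ord2_ind; rewrite !mxE. Qed.

Lemma mx2_scalar a : a%:M = mx2 a 0 0 a.
Proof. by apply/matrixP; do 2!elim/ord2_ind; rewrite !mxE. Qed.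

Definition mx2E := (mx2M, mx2D, mx2N, mx2Z, mx2_scalar).

Lemma eval_genE z :
  [/\ eval_gen q z (GXp 0) = mx2 0 0 z 0, eval_gen q z (GXp 1) = mx2 0 1 0 0,
      eval_gen q z (GXm 0) = mx2 0 z^-1 0 0 & eval_gen q z (GXm 1) = mx2 0 0 1 0] /\
  [/\ eval_gen q z (GK 0) = mx2 q^-1 0 0 q, eval_gen q z (GK 1) = mx2 q 0 0 q^-1,
      eval_gen q z (GKinv 0) = mx2 q 0 0 q^-1 & eval_gen q z (GKinv 1) = mx2 q^-1 0 0 q].
Proof.
split; split; apply/matrixP; do 2!elim/ord2_ind;
  by rewrite !mxE /= ?mxE ?(mulr0, mulr1, addr0, add0r).
Qed.

Section Evaluation.

Variable z : K.
Hypotheses (z_neq0 : z != 0) (q2_neq1 : q ^+ 2 != 1).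

Local Arguments eval_gen : simpl never.

Lemma eval_rel s t : uq_rel q s t ->
  eval (@scalar_mx K 2) (eval_gen q z) s = eval (@scalar_mx K 2) (eval_gen q z) t.
Proof.
have [[Ep0 Ep1 Em0 Em1] [Ek0 Ek1 Ev0 Ev1]] := eval_genE z.
case=> [i|i|i j|i j|i j|i j|i j ij|i j ij].
all: elim/ord2_ind: i ij || elim/ord2_ind: i.
all: try (elim/ord2_ind: j || elim/ord2_ind: j ij).
all: move=> // *.
all: rewrite /= ?(Ep0, Ep1, Em0, Em1, Ek0, Ek1, Ev0, Ev1) !mx2E.
all: congr mx2.
all: rewrite /cartan /= ?opprK -?exprnN -?exprnP.
(* Makes the denominator q - 1/q of the commutator relation invertible. *)
all: have qq1 : q * q - 1 != 0 by rewrite subr_eq0.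
all: by field; rewrite ?q_neq0 ?z_neq0 ?qq1.
Qed.

Lemma evalT_cls s :
  evalT z (cls (uq_rel q) s) = eval (@scalar_mx K 2) (eval_gen q z) s.
Proof.
apply: palg_lift_cls eval_rel s.
- by move=> a b; rewrite raddfD.
- exact: scalar_mxM.
- by [].
- by move=> a y; apply/esym/scalar_mxC.
Qed.

Lemma evalT_ugen g : evalT z (ugen q g) = eval_gen q z g.
Proof. exact: evalT_cls. Qed.

Lemma evalTD x y : evalT z (x + y : Uq q) = evalT z x + evalT z y.
Proof. by elim/palgW: x => s; elim/palgW: y => t; rewrite -clsD !evalT_cls. Qed.

Lemma evalTM x y : evalT z (x * y : Uq q) = evalT z x * evalT z y.
Proof. by elim/palgW: x => s; elim/palgW: y => t; rewrite -clsM !evalT_cls. Qed.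

Lemma evalT1 : evalT z (1 : Uq q) = 1.
Proof. exact: evalT_cls (Cst 1). Qed.

Lemma evalTZ a x : evalT z (a *: x : Uq q) = a *: evalT z x.
Proof. by rewrite -[a *: x]scal_mull evalTM -clsC evalT_cls /= [LHS]mul_scalar_mx. Qed.

Lemma counit_rel s t : uq_rel q s t ->
  eval id (@counit_gen K) s = eval id (@counit_gen K) t.
Proof.
case=> [i|i|i j|i j|i j|i j|i j ij|i j ij] /=; rewrite ?(mulr0, mul0r, mulr1, addr0) //.
by case: ifP => _ /=; rewrite ?mulr1 ?subrr ?mulr0.
Qed.

Lemma counit_cls s : counit (cls (uq_rel q) s) = eval id (@counit_gen K) s.
Proof. by apply: palg_lift_cls counit_rel s => //; apply: mulrC. Qed.

Lemma counit_ugen g : counit (ugen q g) = counit_gen K g.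
Proof. exact: counit_cls. Qed.

Lemma counitD x y : counit (x + y : Uq q) = counit x + counit y.
Proof. by elim/palgW: x => s; elim/palgW: y => t; rewrite -clsD !counit_cls. Qed.

Lemma counitM x y : counit (x * y : Uq q) = counit x * counit y.
Proof. by elim/palgW: x => s; elim/palgW: y => t; rewrite -clsM !counit_cls. Qed.

Lemma counit1 : counit (1 : Uq q) = 1.
Proof. exact: counit_cls (Cst 1). Qed.

Lemma counitZ a x : counit (a *: x : Uq q) = a * counit x.
Proof. by rewrite -[a *: x]scal_mull counitM -clsC counit_cls. Qed.

(* [2 * 1] is convertible to [2], which is what lets both sides have one type. *)
Lemma tensmx_scalar1 (A : 'M[K]_2) (a : K) :
  tensmx A (a%:M : 'M_1) = (a *: A : 'M_(2 * 1)).
Proof.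
apply/matrixP=> i j; case: (mxtens_indexP i) => i1 i2; case: (mxtens_indexP j) => j1 j2.
rewrite tensmxE !mxE !ord1 mulrC; congr (_ * A _ _); apply/val_inj => /=.
  by rewrite muln1 addn0.
by rewrite muln1 addn0.
Qed.

Lemma tens_eval_rel s t : @tens_rel K q s t ->
  eval (@scalar_mx K (2 * 1))
    (fun ab => tensmx (evalT z ab.1) (counit ab.2)%:M) s =
  eval (@scalar_mx K (2 * 1))
    (fun ab => tensmx (evalT z ab.1) (counit ab.2)%:M) t.
Proof.
case=> [a a' b|a b b'|c a b|c a b|a a' b b'|] /=; rewrite !tensmx_scalar1.
- by rewrite evalTD scalerDr.
- by rewrite counitD scalerDl.
- by rewrite evalTZ scalerA mulrC -scalerA [RHS]mul_scalar_mx.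
- by rewrite counitZ -scalerA [RHS]mul_scalar_mx.
- by rewrite evalTM counitM -scalerA -[RHS]scalerAl -scalerAr.
- by rewrite evalT1 counit1 scale1r.
Qed.

Lemma evalT_counit_cls s : evalT_counit z (cls (@tens_rel K q) s) =
  eval (@scalar_mx K (2 * 1))
    (fun ab => tensmx (evalT z ab.1) (counit ab.2)%:M) s.
Proof.
apply: palg_lift_cls tens_eval_rel s.
- by move=> a b; rewrite raddfD.
- exact: scalar_mxM.
- by [].
- by move=> a y; apply/esym/scalar_mxC.
Qed.

Lemma evalT_counit_tens a b : evalT_counit z (tens a b) = counit b *: evalT z a.
Proof. by rewrite [LHS]evalT_counit_cls /= tensmx_scalar1. Qed.

Lemma evalT_counitD x y :
  evalT_counit z (x + y : UqUq q) = evalT_counit z x + evalT_counit z y.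
Proof. by elim/palgW: x => s; elim/palgW: y => t; rewrite -clsD !evalT_counit_cls. Qed.

Lemma evalT_counitM x y :
  evalT_counit z (x * y : UqUq q) = evalT_counit z x * evalT_counit z y.
Proof. by elim/palgW: x => s; elim/palgW: y => t; rewrite -clsM !evalT_counit_cls. Qed.

(** Both sides are algebra maps in b, and on generators this is the counit axiom. *)
Lemma evalT_counit_Delta (b : Uq q) : evalT_counit z (Delta b) = evalT z b.
Proof.
elim/palgW: b; elim=> [g|a|s IHs t IHt|s IHs t IHt]; last 2 first.
- by rewrite clsD DeltaD evalT_counitD IHs IHt evalTD.
- by rewrite clsM DeltaM evalT_counitM IHs IHt evalTM.
- rewrite [X in Delta X](_ : _ = ugen q g) // [X in evalT _ X](_ : _ = ugen q g) //.
  rewrite Delta_ugen; case: g => i /=; rewrite ?evalT_counitD !evalT_counit_tens;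
  by rewrite ?counit1 ?counit_ugen /= ?scale1r ?scale0r ?addr0 ?add0r.
by rewrite clsC DeltaZ Delta1 -tens11 -tensZr evalT_counit_tens counitZ counit1 mulr1 evalTZ.
Qed.

End Evaluation.

(** * The intertwining equation on the generators of [Bsub] *)

Lemma evalT_B0p (dp z : K) : z != 0 -> q ^+ 2 != 1 ->
  evalT z (B0p q dp) = mx2 0 0 (q ^- 2 * (z - dp * q)) 0.
Proof.
move=> z0 q21; rewrite /B0p /xip' -scaleNr evalTD // evalTZ // !evalTM // !evalT_ugen //.
have [[-> _ _ ->] [-> _ -> _]] := eval_genE z.
by rewrite !mx2E; congr mx2; field.
Qed.

(** Factored, like the image of [B0p], to exhibit [dm / q] and [dp * q], the two combinations later
    set equal to c. *)
Lemma evalT_B0m (dm z : K) : z != 0 -> q ^+ 2 != 1 ->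
  evalT z (B0m q dm) = mx2 0 (q * (z^-1 - dm / q)) 0 0.
Proof.
move=> z0 q21; rewrite /B0m /xip' -scaleNr evalTD // evalTZ // !evalTM // !evalT_ugen //.
have [[_ -> -> _] [-> _ _ ->]] := eval_genE z.
by rewrite !mx2E; congr mx2; field; rewrite ?q_neq0 ?z0.
Qed.

Lemma evalT_kk (z : K) : z != 0 -> q ^+ 2 != 1 ->
  evalT z (k 0 * kV 1) = mx2 (q ^- 2) 0 0 (q ^+ 2).
Proof.
move=> z0 q21; rewrite evalTM // !evalT_ugen //.
have [_ [-> _ _ ->]] := eval_genE z.
by rewrite !mx2E; congr mx2; field.
Qed.

(** For a fixed matrix, the elements b that it intertwines form a subalgebra. *)
Lemma intertwines_gen (dp dm z : K) (Kz : 'M[K]_2) : z != 0 -> q ^+ 2 != 1 ->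
  intertwines q dp dm z Kz <->
  forall b, [\/ b = k 0 * kV 1, b = B0p q dp | b = B0m q dm] ->
    evalT z^-1 b * Kz = Kz * evalT z b.
Proof.
move=> z0 q21; have zV0 : z^-1 != 0 by rewrite invr_eq0.
split=> [itw b genb | itw b].
  have := itw b (sg_in genb).
  by rewrite !evalT_counit_Delta.
rewrite !evalT_counit_Delta // => Sb.
suff : evalT z^-1 b * Kz = Kz * evalT z b by [].
elim: b / Sb => [b|| x y _ IHx _ IHy| a x _ IHx| x y _ IHx _ IHy].
- exact: itw.
- by rewrite !evalT1 // mul1r mulr1.
- by rewrite !evalTD // mulrDl mulrDr IHx IHy.
- by rewrite !evalTZ // -scalerAl -scalerAr IHx.
- by rewrite !evalTM // -mulrA IHy mulrA IHx mulrA.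
Qed.

Lemma intertwinesP (dp dm c z : K) (Kz : 'M[K]_2) :
    z != 0 -> q ^+ 4 != 1 -> dp * q = c -> dm / q = c ->
  intertwines q dp dm z Kz <->
  [/\ Kz 0 1 = 0, Kz 1 0 = 0 & (z^-1 - c) * Kz 0 0 = (z - c) * Kz 1 1].
Proof.
move=> z0 q41 dpc dmc.
have q21 : q ^+ 2 != 1.
  by apply: contra q41 => /eqP q21; rewrite (exprM q 2 2) q21 expr1n.
have zV0 : z^-1 != 0 by rewrite invr_eq0.
have qV2 : q ^- 2 != 0 by rewrite invr_eq0.
(* This is the difference of the two eigenvalues of k_0 k_1^-1, by which the off-diagonal entries
   get multiplied. *)
have q4 : q ^+ 2 - q ^- 2 != 0.
  apply: contra q41; rewrite subr_eq0 => /eqP q4.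
  by rewrite (exprD q 2 2) {1}q4 mulVf.
rewrite intertwines_gen // (mx2_eta Kz); move: (Kz 0 0) (Kz 0 1) (Kz 1 0) (Kz 1 1).
move=> k00 k01 k10 k11; rewrite !mxE /=; split=> [itw | [-> -> e] b].
  (* The Cartan generator gives the two zeros and [B0p] the scalar equation; in the converse, [B0m]
     leads to the same scalar equation. *)
  have := itw _ (Or31 _ _ erefl); have := itw _ (Or32 _ _ erefl).
  rewrite !evalT_kk // !evalT_B0p // dpc !mx2E.
  rewrite !(mul0r, mulr0, addr0, add0r).
  move=> /mx2_inj [_ _ e _] /mx2_inj [_ e01 e10 _]; split.
  - by apply: (mulfI q4); rewrite mulr0 mulrBl e01 mulrC subrr.
  - by apply: (mulfI q4); rewrite mulr0 mulrBl e10 mulrC subrr.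
  - by apply: (mulfI qV2); rewrite mulrA e mulrCA [k11 * _]mulrC.
case=> ->; rewrite ?evalT_kk ?evalT_B0p ?evalT_B0m // !mx2E.
- by rewrite !(mul0r, mulr0, addr0, add0r) ![k00 * _]mulrC ![k11 * _]mulrC.
- by rewrite !(mul0r, mulr0, addr0, add0r) dpc; congr mx2; rewrite -mulrA e; ring.
- by rewrite !(mul0r, mulr0, addr0, add0r) dmc invrK; congr mx2; rewrite -mulrA -e; ring.
Qed.

(** * The reflection equation for diagonal K *)

Lemma on_legs_diag (Kz : 'M[K]_2) : Kz 0 1 = 0 -> Kz 1 0 = 0 ->
  on13 (Kz : 'M_(2 * 1)) = diag_mx (\row_j Kz (leg1 j) (leg1 j)) /\
  on23 (Kz : 'M_(2 * 1)) = diag_mx (\row_j Kz (leg2 j) (leg2 j)).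
Proof.
move=> k01 k10; rewrite (mx2_eta Kz) k01 k10.
by split; apply/matrixP=> -[[|[|[|[|//]]]] ?] -[[|[|[|[|//]]]] ?];
  rewrite !mxE /= ?mulr1n ?mulr0n.
Qed.

Lemma sum_legs (F : 'I_(2 * 2 * 1) -> K) : \sum_k F k =
  F (@Ordinal 4 0 isT) + F (@Ordinal 4 1 isT) + F (@Ordinal 4 2 isT) + F (@Ordinal 4 3 isT).
Proof.
(* [2 * 2 * 1] computes to 4. *)
rewrite (_ : \sum_k F k = \sum_(k < 4) F k) // !big_ord_recr big_ord0 /= add0r.
by do ![congr (_ + _)]; congr F; apply/val_inj.
Qed.

(** R preserves the span of v_1 (x) v_2 and v_2 (x) v_1, and outside it both sides agree at once. On
    this block the diagonal entries are symmetric in z/w and zw, and the two off-diagonal entries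
    give the assumed equation up to sign. *)
Lemma reflection_eq_diag (z w : K) (Kz Kw : 'M[K]_2) :
    Kz 0 1 = 0 -> Kz 1 0 = 0 -> Kw 0 1 = 0 -> Kw 1 0 = 0 ->
    let r u := (u - 1) / (q * u - q^-1) in
    Kw 0 0 * (r (z / w) * Kz 0 0 * (1 - q * r (z * w))
                + (1 - r (z / w) / q) * Kz 1 1 * r (z * w)) =
    Kw 1 1 * (r (z * w) * Kz 0 0 * (1 - q * r (z / w))
                + (1 - r (z * w) / q) * Kz 1 1 * r (z / w)) ->
  reflection_eq q z w Kz Kw.
Proof.
move=> z01 z10 w01 w10 r e; rewrite /reflection_eq.
have [-> _] := on_legs_diag z01 z10; have [_ ->] := on_legs_diag w01 w10.
rewrite !mul_mx_diag !mul_diag_mx.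
rewrite (mx2_eta Kz) (mx2_eta Kw) z01 z10 w01 w10.
move: (Kz 0 0) (Kz 1 1) (Kw 0 0) (Kw 1 1) e => a b a' b' /eqP; rewrite -subr_eq0 => /eqP e.
apply/matrixP=> i j; rewrite !mxE !sum_legs !mxE.
rewrite -/(r (z / w)) -/(r (z * w)); move: (r (z / w)) (r (z * w)) e => ru rv e.
case: i => -[|[|[|[|//]]]] ?; case: j => -[|[|[|[|//]]]] ? /=.
all: rewrite ?mulr1n ?mulr0n; try by ring.
all: apply/eqP; rewrite -subr_eq0; apply/eqP.
- by rewrite -[RHS]e; ring.
- by rewrite -[RHS]oppr0 -[in RHS]e; ring.
Qed.

(** After multiplication by z the solutions (a, b) form the line spanned by (z (z - c), 1 - c z),
    unless both coefficients vanish, that is z = 1/z = c. *)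
Lemma K_diag_param (c z a b : K) : z != 0 -> (z^-1 - c) * a = (z - c) * b ->
  (exists t, a = t * (z * (z - c)) /\ b = t * (1 - c * z)) \/ (c = z /\ (z == 1) || (z == -1)).
Proof.
move=> z0 e; have [zc|zc] := eqVneq (z - c) 0; last first.
  left; exists (a / (z * (z - c))); split; first by field; rewrite zc z0.
  apply: (mulfI zc); rewrite -e; field; by rewrite zc z0.
have cz : c = z by apply/esym/eqP; rewrite -subr_eq0 zc.
have [zVc|zVc] := eqVneq (z^-1 - c) 0.
  right; split=> //; rewrite -sqrf_eq1; apply/eqP.
  by move/eqP: zVc; rewrite subr_eq0 cz expr2 => /eqP {1}<-; rewrite mulVf.
(* Here z = c forces a = 0, so t is read off from b. *)
left; exists (b / (1 - c * z)).
have d0 : 1 - c * z != 0.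
  have -> : 1 - c * z = z * (z^-1 - c) by field.
  by rewrite mulf_neq0.
split; last by rewrite divfK.
by rewrite zc !mulr0; apply: (mulfI zVc); rewrite e zc mul0r mulr0.
Qed.

(** This is the equation of [reflection_eq_diag] with the denominators and a factor q - 1/q
    cancelled; q no longer occurs. *)
Lemma boundary_identity (c z w a b a' b' : K) : z != 0 -> w != 0 ->
    (z^-1 - c) * a = (z - c) * b -> (w^-1 - c) * a' = (w - c) * b' ->
  a' * ((z - w) * a + z * (z * w - 1) * b) =
  w * b' * ((z * w - 1) * a + z * (z - w) * b).
Proof.
move=> z0 w0 ez ew.
case: (K_diag_param z0 ez) => [[t [-> ->]]|[cz]];
  case: (K_diag_param w0 ew) => [[s [-> ->]]|[cw]].
- ring.
(* At w = c = 1 or -1 the pair (a', b') is free, and the two factors multiplying a' and b'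
   vanish. *)
- by rewrite cw => /orP[] /eqP ->; ring.
- by rewrite cz => /orP[] /eqP ->; ring.
- by rewrite -cz -cw => /orP[] /eqP -> _; ring.
Qed.

Lemma diag_reflection (c z w : K) (Kz Kw : 'M[K]_2) :
    z != 0 -> w != 0 -> q * (z / w) - q^-1 != 0 -> q * (z * w) - q^-1 != 0 ->
    Kz 0 1 = 0 -> Kz 1 0 = 0 -> Kw 0 1 = 0 -> Kw 1 0 = 0 ->
    (z^-1 - c) * Kz 0 0 = (z - c) * Kz 1 1 ->
    (w^-1 - c) * Kw 0 0 = (w - c) * Kw 1 1 ->
  reflection_eq q z w Kz Kw.
Proof.
move=> z0 w0 du dv z01 z10 w01 w10 ez ew; apply: reflection_eq_diag => //=.
have := boundary_identity z0 w0 ez ew.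
move: (Kz 0 0) (Kz 1 1) (Kw 0 0) (Kw 1 1) => a b a' b' e.
have dv' : q * (z * w) * q - 1 != 0.
  by rewrite (_ : _ - 1 = (q * (z * w) - q^-1) * q) ?mulf_neq0 //; field.
have du' : q * z * q + -1 * w != 0.
  rewrite (_ : _ + _ = (q * (z / w) - q^-1) * (q * w)) ?mulf_neq0 //.
  by field; rewrite q_neq0 w0.
(* The entries 1 - q r and 1 - r/q are q - 1/q and u (q - 1/q) over q u - 1/q, where u is the
   argument of R; hence this common factor. *)
pose f := (q - q^-1) / (w * (q * (z / w) - q^-1) * (q * (z * w) - q^-1)).
rewrite [LHS](_ : _ = f * (a' * ((z - w) * a + z * (z * w - 1) * b))); last first.
  by rewrite /f; field; rewrite q_neq0 w0 dv' du'.
by rewrite e /f; field; rewrite q_neq0 w0 dv' du'.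
Qed.

(** * Existence and uniqueness of the intertwiner *)

Lemma intertwiner_exists (dp dm c z : K) :
    z != 0 -> q ^+ 4 != 1 -> dp * q = c -> dm / q = c ->
  exists2 Kz : 'M[K]_(2 * 1), Kz != 0 & intertwines q dp dm z Kz.
Proof.
move=> z0 q41 dpc dmc; pose D := mx2 (z - c) 0 0 (z^-1 - c).
have [D0|D0] := eqVneq D 0; last first.
  by exists D => //; apply/(intertwinesP D z0 q41 dpc dmc); rewrite !mxE mulrC.
(* When D = 0 the scalar equation is empty, and any diagonal matrix intertwines. *)
exists (1 : 'M[K]_2).
  by apply/eqP => /matrixP /(_ 0 0) /eqP; rewrite !mxE oner_eq0.
apply/(intertwinesP 1 z0 q41 dpc dmc); rewrite !mxE /= !mulr1; split=> //.
have := congr1 (fun M : 'M_2 => M 0 0) D0; have := congr1 (fun M : 'M_2 => M 1 1) D0.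
by rewrite !mxE /= => -> ->.
Qed.

(** Both pairs lie in the kernel of the nonzero linear form (p, -s), which is a line. *)
Lemma proportional (p s a b a' b' : K) :
    (p != 0) || (s != 0) -> (a != 0) || (b != 0) ->
    p * a = s * b -> p * a' = s * b' ->
  exists t, a' = t * a /\ b' = t * b.
Proof.
move=> ps ab e e'.
have cross : a * b' = a' * b.
  case/orP: ps => n0; apply: (mulfI n0).
    by rewrite mulrA e -mulrA [b * _]mulrC mulrA -e' mulrA.
  by rewrite mulrCA -e' mulrCA [in RHS]mulrCA -e; ring.
case/orP: ab => n0.
  by exists (a' / a); rewrite divfK // mulrAC -cross mulrAC divff ?mul1r.
by exists (b' / b); rewrite divfK // mulrAC [b' * a]mulrC cross mulfK.
Qed.

(** The condition on z keeps the scalar equation of [intertwinesP] nonzero, so its diagonal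
    solutions form a line. *)
Lemma intertwiner_unique (dp dm c z : K) (Kz Kz' : 'M[K]_(2 * 1)) :
    z != 0 -> q ^+ 4 != 1 -> dp * q = c -> dm / q = c ->
    (z != c) || (z^-1 != c) ->
    intertwines q dp dm z Kz -> Kz != 0 -> intertwines q dp dm z Kz' ->
  exists a, Kz' = a *: Kz.
Proof.
move=> z0 q41 dpc dmc zc.
move=> /(intertwinesP Kz z0 q41 dpc dmc) [k01 k10 e] Kz0.
move=> /(intertwinesP Kz' z0 q41 dpc dmc) [k01' k10' e'].
have [||t [t0 t1]] := proportional _ _ e e'.
- by rewrite !subr_eq0 orbC.
- rewrite -negb_and; apply: contra Kz0 => /andP[/eqP k00 /eqP k11].
  apply/eqP; rewrite (mx2_eta Kz) k00 k01 k10 k11.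
  by apply/matrixP; do 2!elim/ord2_ind; rewrite !mxE.
exists t; rewrite [LHS]mx2_eta [in RHS](mx2_eta Kz) mx2Z.
by rewrite t0 t1 k01 k10 k01' k10' mulr0.
Qed.

End QuantumAffine.

(** * From transcendental q to the result *)

Lemma transcendental_exp_neq1 (F E : fieldType) (f : {rmorphism F -> E}) (x : E) n :
  ~ algebraicOver f x -> (n > 0)%N -> x ^+ n != 1.
Proof.
move=> trx n0; apply/negP => /eqP xn1; apply: trx; exists ('X^n - 1).
  by rewrite -size_poly_eq0 size_XnsubC.
by rewrite rmorphB /= map_polyXn rmorph1 rootE !hornerE xn1 subrr.
Qed.

Lemma transcendental_neq0 (F E : fieldType) (f : {rmorphism F -> E}) (x : E) :
  ~ algebraicOver f x -> x != 0.
Proof.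
move=> trx; apply/negP => /eqP x0; apply: trx; exists 'X; first by rewrite -size_poly_eq0 size_polyX.
by rewrite map_polyX rootE hornerX x0.
Qed.

(** That the equation defines K(z) is expressed by existence of a nonzero solution and uniqueness up
    to a scalar away from z = 1/z = c. The reflection equation is asserted for every family of
    intertwiners, however normalised, wherever the denominators of both R-matrices are nonzero. *)
Theorem proposition2p2 (R : realType) (q dp dm c : R[i])
    (q_transcendental : ~ algebraicOver (ratr : rat -> R[i]) q)
    (dp_eq : dp * q = c) (dm_eq : dm / q = c) :
  [/\ left_coideal (Bsub q dp dm),
      (forall z : R[i], z != 0 ->
         exists2 Kz : 'M[R[i]]_(2 * 1), Kz != 0 & intertwines q dp dm z Kz),
      (forall (z : R[i]) (Kz Kz' : 'M[R[i]]_(2 * 1)), z != 0 ->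
         (z != c) || (z^-1 != c) ->
         intertwines q dp dm z Kz -> Kz != 0 -> intertwines q dp dm z Kz' ->
         exists a : R[i], Kz' = a *: Kz)
    & (forall Kmat : R[i] -> 'M[R[i]]_(2 * 1),
         (forall z, z != 0 -> intertwines q dp dm z (Kmat z)) ->
         forall z w : R[i], z != 0 -> w != 0 ->
           q * (z / w) - q^-1 != 0 -> q * (z * w) - q^-1 != 0 ->
           reflection_eq q z w (Kmat z) (Kmat w))].
Proof.
have q0 := transcendental_neq0 q_transcendental.
have q41 := transcendental_exp_neq1 q_transcendental (isT : 0 < 4)%N.
split.
- exact: Bsub_left_coideal.
- by move=> z z0; apply: (intertwiner_exists q0 z0 q41 dp_eq dm_eq).
- by move=> z Kz Kz' z0; apply: (intertwiner_unique q0 z0 q41 dp_eq dm_eq).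
move=> Kmat itw z w z0 w0 du dv.
have [z01 z10 ez] := (intertwinesP q0 _ z0 q41 dp_eq dm_eq).1 (itw z z0).
have [w01 w10 ew] := (intertwinesP q0 _ w0 q41 dp_eq dm_eq).1 (itw w w0).
exact: (diag_reflection q0 z0 w0 du dv z01 z10 w01 w10 ez ew).
Qed.
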